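(* Let $A>0$, $\sigma>0$. There are $c>0$, $\lambda_0\geq 0$, $n_0\geq 1$ such that for any $n\geq n_0$ and any independent sequence $X_1,\dots,X_n$ of real random variables with $$E(X_i)=0,\quad E(|X_i|^3)\leq A,\quad E(X_i^2)\geq\sigma^2,\qquad i=1,\dots,n,$$ the following holds. For any $\lambda\geq\lambda_0$, $$P_0\bigl(\max_{i=1,\dots,n}|S_i|\leq\lambda,\ |S_n|\leq\lambda/2\bigr)\geq\exp\Bigl(-\frac{cn}{\lambda^2}\Bigr).$$
   Context: Under $P_0$ the walk is $S_0=0$, $S_k=X_1+\dots+X_k$. *)

(* Defs.v *)
From HB Require Import structures.
From mathcomp Require Import all_boot all_order all_algebra.
From mathcomp Require Import all_classical all_reals all_analysis.

Set Implicit Arguments.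
Unset Strict Implicit.
Unset Printing Implicit Defensive.

Import Order.TTheory GRing.Theory Num.Theory.

Local Open Scope classical_set_scope.
Local Open Scope ring_scope.

(* Mutual independence: the product rule over every subfamily. *)
Definition independent_RVs (d : measure_display) (T : measurableType d)
    (R : realType) (P : probability T R) (I : finType)
    (X : I -> {RV P >-> R}) : Prop :=
  forall (J : {set I}) (B : I -> set R),
    (forall i, measurable (B i)) ->
    P [set w | forall i, i \in J -> B i (X i w)] =
    (\prod_(i in J) P (X i @^-1` B i))%E.

(* S_k = X_1 + ... + X_k; with 0-based indices, X_{i+1} is [X i], so that
   S_k sums the [X i] with i < k, and S_0 = 0. *)
Definition walk (d : measure_display) (T : measurableType d) (R : realType)
    (P : probability T R) (n : nat) (X : 'I_n -> {RV P >-> R})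
    (k : nat) (w : T) : R :=
  \sum_(i < n | (i < k)%N) X i w.

(* Main.v *)
Require Import Defs.
From HB Require Import structures.
From mathcomp Require Import all_boot all_order all_algebra.
From mathcomp Require Import all_classical all_reals all_analysis.
From mathcomp Require Import measurable_realfun.
From mathcomp Require Import ring lra.

Set Implicit Arguments.
Unset Strict Implicit.
Unset Printing Implicit Defensive.

Import Order.TTheory GRing.Theory Num.Theory.

Local Open Scope classical_set_scope.
Local Open Scope ring_scope.

(** Put L = lambda / 2. It is enough to bound from below the probability that
    the walk never leaves [-L, L]. That event is {|Z_n| <= L}, where Z is the
    walk stopped at its first exit from [-L, L].

    The bound comes from a test function whose expectation along Z decays slowly.
    Let bump L z = (max 0 (L^2 - z^2))^2. It vanishes outside [-L, L] and is at
    most L^4 = bump L 0, so that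
      L^4 P(|Z_n| <= L) >= E bump L (Z_n).
    If X is one of the increments, then
      E bump L (z + X) >= (1 - K / L^2) bump L z       (|z| <= L)
    for some K = K(A, sigma), as soon as L is large; this is
    [integral_bump_ge]. Away from the boundary it is a second-order expansion:
    the loss is of order L^2 E X^2, while bump L z is of order L^4. Close to
    the boundary bump L z is too small to pay for any loss, but there the kink of
    the bump helps: a jump outwards costs at most what the bump was worth,
    whereas a jump u inwards gains about 4 z^2 u^2. The gain is of order L^2,
    because the one-sided second moment of X is bounded below: a centred variable
    with E X^2 >= sigma^2 and E |X|^3 <= A satisfies
    E |X| >= sigma^4 / A, hence E X^+ = E X^- >= sigma^4 / (2 A).
    The third-order error is only of order L E |X|^3.

    All these estimates are proved pointwise, as minorants of x |-> bump L (z + x)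
    by combinations of 1, x, x^2 and |x|^3 ([bump_cubic_minorant]), which
    are then integrated. Since Z_k is a function of X_1, ..., X_k, it is independent
    of X_{k+1} and Fubini's theorem gives
    E bump L (Z_n) >= (1 - K / L^2)^n L^4. Finally 1 - t >= exp (- 2 t) for
    0 <= t <= 1/2, which turns this power into exp (- c n / lambda^2). *)

(** * Pointwise bounds for the test function *)

Section PointwiseBounds.
Variable R : realFieldType.
Implicit Types V b Y u r s L x z : R.

Lemma le_1Dcube x : 0 <= x -> x <= 1 + x ^+ 3 /\ x ^+ 2 <= 1 + x ^+ 3.
Proof.
move=> x0; have : 0 <= (x - 1) ^+ 2 * (x + 1) by rewrite mulr_ge0 ?sqr_ge0 ?addr_ge0.
by have := sqr_ge0 x; split; lra.
Qed.

(** Second-order expansion of the square of the positive part, with the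
    remainder (b^+)^2 instead of b^2: moving down never costs more than the
    linear term predicts, and moving up gains the full square. *)
Lemma sqr_maxr0D V b : 0 <= V ->
  V ^+ 2 + V *+ 2 * b + Num.max 0 b ^+ 2 <= Num.max 0 (V + b) ^+ 2.
Proof. by move=> V0; case: (lerP 0 b); case: (lerP 0 (V + b)); nra. Qed.

(** With Y = |z| and u the displacement towards the origin, 2 Y u - u^2 is the
    increase of L^2 - z^2; this bounds the gain term of [sqr_maxr0D] below. *)
Lemma sqr_maxr0_parabola Y u : 0 <= Y ->
  4 * Y ^+ 2 * Num.max 0 u ^+ 2 - 4 * Y * `|u| ^+ 3 <=
  Num.max 0 (2 * Y * u - u ^+ 2) ^+ 2.
Proof.
move=> Y0; have [u0|u0] := ltrP u 0.
  rewrite expr0n /= mulr0 sub0r.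
  apply: (le_trans _ (sqr_ge0 _)).
  by rewrite oppr_le0 mulr_ge0 ?exprn_ge0// mulr_ge0.
rewrite (ger0_norm u0).
have [h|h] := ltrP (2 * Y * u - u ^+ 2) 0.
  have Yu : Y <= u by nra.
  rewrite expr0n /=.
  have : 0 <= Y * u ^+ 2 * (u - Y) by rewrite !mulr_ge0 ?sqr_ge0 ?subr_ge0.
  lra.
by have := sqr_ge0 (u ^+ 2); lra.
Qed.

(** Integrated over a centred u, this bounds E (u^+)^2 below by the second and
    third moments. It combines s (u + |u|) - s^2 <= (u^+)^2 with
    2 r u^2 - r^2 |u|^3 <= |u|, which are the duals of the Cauchy-Schwarz
    inequalities (E u^+)^2 <= E (u^+)^2 and (E u^2)^2 <= E |u| E |u|^3. *)
Lemma sqr_maxr0_cubic r s u : 0 <= s ->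
  s * u + s * (2 * r * u ^+ 2 - r ^+ 2 * `|u| ^+ 3) - s ^+ 2 <=
  Num.max 0 u ^+ 2.
Proof.
move=> s0.
have key : 2 * r * u ^+ 2 - r ^+ 2 * `|u| ^+ 3 <= `|u|.
  have : 0 <= `|u| * (1 - r * `|u|) ^+ 2 by rewrite mulr_ge0 ?sqr_ge0.
  by rewrite -(real_normK (num_real u)); lra.
have h := ler_wpM2l s0 key.
have [u0|u0] := ltrP u 0.
  rewrite (ltr0_norm u0) in h *; have := sqr_ge0 s; nra.
rewrite (ger0_norm u0) in h *; have := sqr_ge0 (u - s); nra.
Qed.

Definition bump L z := Num.max 0 (L ^+ 2 - z ^+ 2) ^+ 2.

Lemma bump_ge0 L z : 0 <= bump L z.
Proof. exact: sqr_ge0. Qed.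

Lemma bump_le L z : bump L z <= L ^+ 4.
Proof.
rewrite /bump -[4%N]/(2 * 2)%N exprM lerXn2r ?nnegrE ?sqr_ge0 ?le_max ?lexx//.
by rewrite ge_max sqr_ge0 gerBl sqr_ge0.
Qed.

Lemma bump0 L : bump L 0 = L ^+ 4.
Proof. by rewrite /bump expr0n subr0 max_r ?sqr_ge0// -exprM. Qed.

Lemma bump_out L z : 0 <= L -> L < `|z| -> bump L z = 0.
Proof.
move=> L0 Lz; rewrite /bump max_l ?expr0n// subr_le0 -(real_normK (num_real z)).
by rewrite lerXn2r ?nnegrE// ltW.
Qed.

Lemma bump_in L z : `|z| <= L -> bump L z = (L ^+ 2 - z ^+ 2) ^+ 2.
Proof.
move=> zL; rewrite /bump max_r// subr_ge0 -(real_normK (num_real z)).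
by rewrite lerXn2r ?nnegrE// (le_trans _ zL).
Qed.

Lemma bump_shift L z x : `|z| <= L ->
  bump L z - (L ^+ 2 - z ^+ 2) *+ 2 * (2 * z * x + x ^+ 2) +
    Num.max 0 (- (2 * z * x) - x ^+ 2) ^+ 2 <= bump L (z + x).
Proof.
move=> zL; have V0 : 0 <= L ^+ 2 - z ^+ 2.
  rewrite subr_ge0 -(real_normK (num_real z)).
  by rewrite lerXn2r ?nnegrE// (le_trans _ zL).
rewrite (bump_in zL).
have := sqr_maxr0D (- (2 * z * x) - x ^+ 2) V0.
rewrite /bump (_ : L ^+ 2 - (z + x) ^+ 2 =
  L ^+ 2 - z ^+ 2 + (- (2 * z * x) - x ^+ 2)); last by ring.
by apply: le_trans; rewrite lerD2r; lra.
Qed.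

(** The minorant used far from the boundary, where the gain is dropped. The
    vanishing coefficient keeps the shape of [bump_edge]. *)
Lemma bump_interior L z x : `|z| <= L ->
  bump L z + (- (4 * (L ^+ 2 - z ^+ 2) * z)) * x
    + (- (2 * (L ^+ 2 - z ^+ 2))) * x ^+ 2 + 0 * `|x| ^+ 3 <= bump L (z + x).
Proof.
move=> zL; apply: le_trans (bump_shift x zL).
by have := sqr_ge0 (Num.max 0 (- (2 * z * x) - x ^+ 2)); lra.
Qed.

(** The minorant used near the boundary, where the gain compensates the
    negative second-order term. *)
Lemma bump_edge L z x r s : `|z| <= L -> 0 <= s ->
  (bump L z - 4 * z ^+ 2 * s ^+ 2)
  + (- (4 * (L ^+ 2 - z ^+ 2) * z) - 4 * z ^+ 2 * s * Num.sg z) * x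
  + (8 * z ^+ 2 * s * r - 2 * (L ^+ 2 - z ^+ 2)) * x ^+ 2
  + (- (4 * z ^+ 2 * s * r ^+ 2) - 4 * `|z|) * `|x| ^+ 3 <= bump L (z + x).
Proof.
move=> zL s0; apply: le_trans (bump_shift x zL).
have [->|z0] := eqVneq z 0.
  rewrite !(expr0n, mulr0, mul0r, normr0, subr0, addr0, oppr0, sub0r).
  by have := sqr_ge0 (Num.max 0 (- x ^+ 2)); lra.
(* the displacement towards the origin *)
pose u := - (Num.sg z * x).
have u2 : u ^+ 2 = x ^+ 2 by rewrite /u sqrrN exprMn sqr_sg z0 mul1r.
have nu : `|u| = `|x| by rewrite /u normrN normrM normr_sg z0 mul1r.
have zu : - (2 * z * x) - x ^+ 2 = 2 * `|z| * u - u ^+ 2.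
  by rewrite u2 /u {1}(numEsg z); ring.
have z2 : `|z| ^+ 2 = z ^+ 2 by rewrite real_normK ?num_real.
have e1 := sqr_maxr0_parabola u (normr_ge0 z).
have z4 : 0 <= 4 * z ^+ 2 by rewrite mulr_ge0 ?sqr_ge0.
have e2 := ler_wpM2l z4 (sqr_maxr0_cubic r u s0).
move: e1 e2; rewrite zu z2 nu.
move: (Num.max 0 (_ - _)) (Num.max 0 u) => M1 M2.
rewrite u2 /u; lra.
Qed.

(** The one-step estimate, in terms of numbers m2, m3 that stand for E X^2 and
    E |X|^3; the term in c1 disappears because E X = 0. The cut between
    interior and edge is at L^2 - z^2 = L^2 / D with D = 2 + 4 B / s^2: above it,
    the rate 2 B D / L^2 covers the loss 2 B (L^2 - z^2); below it, the summand 2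
    of D forces z^2 >= L^2 / 2, and the summand 4 B / s^2 makes the loss at
    most a quarter of the gain 4 z^2 s^2. The condition 8 A <= s^2 L does the
    same for the third-order error 4 |z| A. *)
Lemma bump_cubic_minorant L z A B r s m2 m3 :
    0 < s -> 0 <= B -> 0 < L -> 8 * A <= s ^+ 2 * L -> `|z| <= L ->
    m2 <= B -> 0 <= m3 <= A -> 2 * s <= 2 * r * m2 - r ^+ 2 * m3 ->
  exists c0 c1 c2 c3,
    (forall x, c0 + c1 * x + c2 * x ^+ 2 + c3 * `|x| ^+ 3 <= bump L (z + x)) /\
    (1 - 2 * B * (2 + 4 * B / s ^+ 2) / L ^+ 2) * bump L z <=
      c0 + c2 * m2 + c3 * m3.
Proof.
move=> s0 B0 L0 AL zL m2B /andP[m30 m3A] sr.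
pose V := L ^+ 2 - z ^+ 2; pose D := 2 + 4 * B / s ^+ 2.
have V0 : 0 <= V.
  rewrite subr_ge0 -(real_normK (num_real z)).
  by rewrite lerXn2r ?nnegrE// (le_trans _ zL).
have t0 : 0 < s ^+ 2 by rewrite exprn_gt0.
have D0 : 0 <= D by rewrite addr_ge0// divr_ge0 ?mulr_ge0// ltW.
have L20 : 0 < L ^+ 2 by rewrite exprn_gt0.
have k0 : 0 <= 2 * B * D / L ^+ 2.
  by rewrite divr_ge0 ?(ltW L20)// mulr_ge0// mulr_ge0.
rewrite -/D (bump_in zL) -/V.
have [interior|edge] := lerP (L ^+ 2) (D * V).
  do 4 eexists; split; first by move=> x; exact: bump_interior.
  rewrite (bump_in zL) -/V mul0r addr0.
  have : 2 * B <= 2 * B * D / L ^+ 2 * V.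
    have B20 : 0 <= 2 * B by rewrite mulr_ge0.
    by rewrite mulrAC ler_pdivlMr//; have := ler_wpM2l B20 interior; lra.
  move=> /(ler_wpM2r V0); have := ler_wpM2l V0 m2B; lra.
do 4 eexists; split; first by move=> x; exact: (bump_edge x r zL (ltW s0)).
rewrite (bump_in zL) -/V.
have V2 : 0 <= 2 * B * D / L ^+ 2 * V ^+ 2 by rewrite mulr_ge0// sqr_ge0.
have DV : D * V = 2 * V + 4 * B * V / s ^+ 2 by rewrite /D; ring.
have BV0 : 0 <= 4 * B * V / s ^+ 2 by rewrite divr_ge0 ?mulr_ge0// ltW.
have BV : 4 * B * V <= s ^+ 2 * L ^+ 2.
  rewrite -ler_pdivrMl// mulrC; lra.
have zn : z ^+ 2 = `|z| ^+ 2 by rewrite real_normK ?num_real.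
have z2 : L ^+ 2 <= 2 * z ^+ 2 by move: edge; rewrite DV /V in BV0 *; lra.
have Lz : L <= 2 * `|z| by have := normr_ge0 z; nra.
have A0 : 0 <= A by exact: le_trans m3A.
have Az : 4 * `|z| * A <= s ^+ 2 * z ^+ 2.
  rewrite zn; have := ler_wpM2l (ltW t0) Lz; have := normr_ge0 z; nra.
have Bz : 2 * V * m2 <= s ^+ 2 * z ^+ 2.
  have := ler_wpM2l V0 m2B; have := ler_wpM2l (ltW t0) z2; lra.
have Am : 4 * `|z| * m3 <= 4 * `|z| * A by rewrite ler_wpM2l// mulr_ge0.
have gain : 4 * z ^+ 2 * s * (2 * s) <=
    4 * z ^+ 2 * s * (2 * r * m2 - r ^+ 2 * m3).
  by rewrite ler_wpM2l// mulr_ge0 ?(ltW s0)// mulr_ge0 ?sqr_ge0.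
have := mulr_ge0 (ltW t0) (sqr_ge0 z); lra.
Qed.

(** The value r = sigma^2 / A is the one that maximises 2 r sigma^2 - r^2 A. *)
Lemma third_moment_spread A (sigma : R) m2 m3 :
    0 < A -> sigma ^+ 2 <= m2 -> m3 <= A ->
  2 * (sigma ^+ 4 / (2 * A)) <=
    2 * (sigma ^+ 2 / A) * m2 - (sigma ^+ 2 / A) ^+ 2 * m3.
Proof.
move=> A0 hm2 hm3.
have r0 : 0 <= sigma ^+ 2 / A by rewrite divr_ge0 ?sqr_ge0// ltW.
have e1 := ler_wpM2l r0 hm2; have e2 := ler_wpM2l (sqr_ge0 (sigma ^+ 2 / A)) hm3.
have e3 : (sigma ^+ 2 / A) ^+ 2 * A = sigma ^+ 2 / A * sigma ^+ 2.
  by field; rewrite gt_eqF.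
have -> : 2 * (sigma ^+ 4 / (2 * A)) = sigma ^+ 2 / A * sigma ^+ 2.
  by field; rewrite gt_eqF.
lra.
Qed.

End PointwiseBounds.

(** * Integrating cubic minorants *)

Section Moments.
Local Open Scope ereal_scope.
Context d (T : measurableType d) (R : realType) (P : probability T R).

Lemma integrable_of_third_moment (X : {RV P >-> R}) :
  'E_P[fun w => (`|X w| ^+ 3)%R] < +oo ->
  [/\ P.-integrable setT (fun w => (X w)%:E),
      P.-integrable setT (fun w => (X w ^+ 2)%:E) &
      P.-integrable setT (fun w => (`|X w| ^+ 3)%:E)].
Proof.
move=> X3.
have mX : measurable_fun setT X by exact: measurable_funP.
have i3 : P.-integrable setT (fun w => (`|X w| ^+ 3)%:E).
  apply/integrableP; split.
    by apply/measurable_EFinP; apply: measurable_funX; exact: measurableT_comp.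
  move: X3; rewrite unlock; congr (_ < _).
  by apply: eq_integral => w _; rewrite gee0_abs// lee_fin exprn_ge0.
have i1 : P.-integrable setT (fun w => (1 + `|X w| ^+ 3)%:E).
  have i0 := finite_measure_integrable_cst P 1%R measurableT.
  exact: (integrableD measurableT i0 i3).
split=> //; apply: (le_integrable measurableT _ _ i1).
- exact/measurable_EFinP.
- move=> w _ /=; rewrite lee_fin [leRHS]ger0_norm ?addr_ge0 ?exprn_ge0//.
  by have [] := le_1Dcube (normr_ge0 (X w)).
- by apply/measurable_EFinP; apply: measurable_funX.
- move=> w _ /=; rewrite lee_fin [leRHS]ger0_norm ?addr_ge0 ?exprn_ge0//.
  by rewrite normrX; have [] := le_1Dcube (normr_ge0 (X w)).
Qed.

Lemma integral_ge_cubic (X : {RV P >-> R}) (f : R -> R) (M c0 c1 c2 c3 : R) :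
    'E_P[fun w => (`|X w| ^+ 3)%R] < +oo -> 'E_P[X] = 0 ->
    measurable_fun setT f -> (forall x, 0 <= f x <= M)%R ->
    (forall x, c0 + c1 * x + c2 * x ^+ 2 + c3 * `|x| ^+ 3 <= f x)%R ->
  (c0 + c2 * fine 'E_P[fun w => (X w ^+ 2)%R]
      + c3 * fine 'E_P[fun w => (`|X w| ^+ 3)%R])%:E <= \int[P]_w (f (X w))%:E.
Proof.
move=> /integrable_of_third_moment[i1 i2 i3] EX0 mf fM cf.
have i0 : P.-integrable setT (fun=> c0%:E) by exact: finite_measure_integrable_cst.
have j1 := integrableZl measurableT c1 i1.
have j2 := integrableZl measurableT c2 i2.
have j3 := integrableZl measurableT c3 i3.
have j01 := integrableD measurableT i0 j1.
have j012 := integrableD measurableT j01 j2.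
have j := integrableD measurableT j012 j3.
have <- : \int[P]_w (c0%:E + c1%:E * (X w)%:E + c2%:E * (X w ^+ 2)%:E
     + c3%:E * (`|X w| ^+ 3)%:E) =
  (c0 + c2 * fine 'E_P[fun w => (X w ^+ 2)%R]
      + c3 * fine 'E_P[fun w => (`|X w| ^+ 3)%R])%:E.
  rewrite (integralD measurableT j012 j3) (integralD measurableT j01 j2).
  rewrite (integralD measurableT i0 j1) !integralZl//.
  rewrite integral_cst//= probability_setT mule1.
  move: EX0; rewrite !unlock => ->; rewrite mule0 adde0.
  by rewrite !EFinD !EFinM !fineK//; exact: (integrable_fin_num measurableT).
apply: le_integral => //; last by move=> w _; rewrite -!EFinM -!EFinD lee_fin.
apply: measurable_bounded_integrable => //.
- by rewrite /= probability_setT ltry.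
- exact: measurableT_comp.
- exists M; split; first exact: num_real.
  move=> y My w _ /=; have /andP[f0 fM'] := fM (X w).
  by rewrite ger0_norm// (le_trans fM')// ltW.
Qed.

End Moments.

(** * Functions of an independent pair *)

Section IndependentPair.
Local Open Scope ereal_scope.
Context d d1 d2 (T : measurableType d) (T1 : measurableType d1)
  (T2 : measurableType d2) (R : realType) (P : probability T R).
Variables (Z : T -> T1) (X : T -> T2).
Hypotheses (mZ : measurable_fun setT Z) (mX : measurable_fun setT X).

Let mZX : measurable_fun setT (fun w => (Z w, X w)).
Proof. exact: measurable_fun_pair. Qed.

(** Both sides are finite measures in C, and the rectangles form a pi-system
    that generates the product sigma-algebra. *)
Lemma independent_event_of_rectangles (E : set T) : measurable E ->
    (forall A B, measurable A -> measurable B ->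
      P (Z @^-1` A `&` X @^-1` B `&` E) = P (Z @^-1` A `&` X @^-1` B) * P E) ->
  forall C, measurable C ->
    P ((fun w => (Z w, X w)) @^-1` C `&` E) =
    P ((fun w => (Z w, X w)) @^-1` C) * P E.
Proof.
move=> mE rect C mC.
have PE0 : (0 <= fine (P E))%R by rewrite fine_ge0.
pose m1 : {measure set (T1 * T2) -> \bar R} :=
  measure_function_pushforward__canonical__measure_function_Measure
    (mrestr P mE) mZX.
pose m2 : {measure set (T1 * T2) -> \bar R} :=
  mscale (NngNum PE0)
  (measure_function_pushforward__canonical__measure_function_Measure P mZX).
pose G : set_system (T1 * T2) := [set A `*` B | A in measurable & B in measurable].
have m2E D : m2 D = P ((fun w => (Z w, X w)) @^-1` D) * P E.
  transitivity ((fine (P E))%:E * P ((fun w => (Z w, X w)) @^-1` D)) => //.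
  by rewrite fineK ?fin_num_measure// muleC.
have -> : P ((fun w => (Z w, X w)) @^-1` C `&` E) = m1 C by [].
rewrite -m2E; apply: (measure_unique G (fun=> setT)) => //.
- exact: measurable_prod_measurableType.
- move=> _ _ [A1 mA1 [B1 mB1 <-]] [A2 mA2 [B2 mB2 <-]].
  exists (A1 `&` A2); first exact: measurableI.
  by exists (B1 `&` B2); [exact: measurableI|rewrite setXI].
- by move=> _; exists setT => //; exists setT => //; rewrite setXTT.
- by rewrite bigcup_const.
- by move=> _ [A mA [B mB <-]]; rewrite m2E; exact: rect.
- move=> _.
  rewrite [ltLHS](_ : _ = P ((fun w => (Z w, X w)) @^-1` setT `&` E))//.
  by rewrite preimage_setT setTI ltey_eq fin_num_measure.
Qed.

(** The product rule on rectangles says that the joint law is the product of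
    the marginal laws, to which Tonelli's theorem applies. *)
Lemma ge0_integral_independent_pair (f : T1 * T2 -> \bar R) :
    (forall A B, measurable A -> measurable B ->
      P (Z @^-1` A `&` X @^-1` B) = P (Z @^-1` A) * P (X @^-1` B)) ->
    measurable_fun setT f -> (forall y, 0 <= f y) ->
  \int[P]_w f (Z w, X w) = \int[P]_w \int[P]_w' f (Z w, X w').
Proof.
move=> rect mf f0.
pose Zm : {mfun T >-> T1} := HB.pack Z (isMeasurableFun.Build _ _ _ _ _ mZ).
pose Xm : {mfun T >-> T2} := HB.pack X (isMeasurableFun.Build _ _ _ _ _ mX).
pose W : {mfun T >-> (T1 * T2)%type} :=
  HB.pack (fun w => (Z w, X w)) (isMeasurableFun.Build _ _ _ _ _ mZX).
transitivity (\int[distribution P W]_y f y).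
  by rewrite ge0_integral_distribution.
transitivity (\int[(distribution P Zm \x distribution P Xm)%E]_y f y).
  apply: eq_measure_integral => C mC _; apply/esym.
  by apply: product_measure_unique => // A B mA mB; exact: rect.
rewrite fubini_tonelli1// /fubini_F ge0_integral_distribution//=.
- apply: eq_integral => w _; rewrite ge0_integral_distribution//=.
  exact: measurableT_comp.
- exact: measurable_fun_fubini_tonelli_F.
- by move=> z; apply: integral_ge0.
Qed.
End IndependentPair.

(** * The walk stopped at its exit from an interval *)

Section StoppedWalk.
Context d (T : measurableType d) (R : realType) (P : probability T R).
Variables (n : nat) (X : 'I_n -> {RV P >-> R}) (L : R).

(** Recomputing the walk at each step, rather than adding increments, avoids
    an arbitrary value for the increments of index at least n. *)
Fixpoint stopped_walk (k : nat) (w : T) : R :=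
  if k is j.+1 then
    if `|stopped_walk j w| <= L then walk X k w else stopped_walk j w
  else 0.

(** One transition of the stopped walk, as a function of the position and of
    the next increment. *)
Definition stopped_step (zx : R * R) : R :=
  if `|zx.1| <= L then zx.1 + zx.2 else zx.1.

Lemma measurable_stopped_step : measurable_fun setT stopped_step.
Proof.
apply: measurable_fun_ifT => //; last exact: measurable_funD.
by apply: measurable_fun_ler => //; exact: measurableT_comp.
Qed.

Lemma walkS (i : 'I_n) w : walk X i.+1 w = walk X i w + X i w.
Proof.
rewrite /walk (bigD1 i) ?leqnn//= addrC; congr (_ + _).
by apply: eq_bigl => j; rewrite ltnS andbC -ltn_neqAle.
Qed.

Lemma stopped_walk_in k w : `|stopped_walk k w| <= L ->
  stopped_walk k w = walk X k w /\
  (forall j, (j <= k)%N -> `|walk X j w| <= L).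
Proof.
elim: k => [|k IH] /=.
  have w0 : walk X 0 w = 0 by rewrite /walk big_pred0.
  by rewrite w0 => L0; split=> // j; rewrite leqn0 => /eqP ->; rewrite w0.
case: ifPn => Zk; last by rewrite (negPf Zk).
move=> Sk; split=> // j; rewrite leq_eqVlt => /predU1P[->//|].
by rewrite ltnS; case: (IH Zk) => _; apply.
Qed.

Lemma stopped_walkS (i : 'I_n) w :
  stopped_walk i.+1 w = stopped_step (stopped_walk i w, X i w).
Proof.
rewrite [LHS]/= /stopped_step /=; case: ifPn => // /stopped_walk_in[Zi _].
by rewrite walkS Zi.
Qed.

Lemma measurable_walk k : measurable_fun setT (walk X k).
Proof.
rewrite (_ : walk X k =
    (fun w => \sum_(i <- [seq i : 'I_n <- index_enum 'I_n | (i < k)%N]) X i w)).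
  by apply: measurable_sum => i; exact: measurable_funP.
by apply/funext => w; rewrite big_filter.
Qed.

Lemma measurable_stopped_walk k : measurable_fun setT (stopped_walk k).
Proof.
elim: k => [|k IH]; first exact: measurable_cst.
apply: measurable_fun_ifT => //; last exact: measurable_walk.
by apply: measurable_fun_ler => //; exact: measurableT_comp.
Qed.

Let future k (B : 'I_n -> set R) : set T :=
  [set w | forall i : 'I_n, (k <= i)%N -> B i (X i w)].

Let mX i : measurable_fun setT (X i).
Proof. exact: measurable_funP. Qed.

Lemma measurable_future k B : (forall i, measurable (B i)) ->
  measurable (future k B).
Proof.
move=> mB; rewrite (_ : future k B =
    \bigcap_(i in [set i : 'I_n | (k <= i)%N]) X i @^-1` B i).
  apply: fin_bigcap_measurable => // i _.
  by rewrite -[X in measurable X]setTI; exact: mX.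
by [].
Qed.

Hypothesis indepX : independent_RVs X.

Lemma futureE k B : (forall i, measurable (B i)) ->
  P (future k B) = (\prod_(i < n | (k <= i)%N) P (X i @^-1` B i))%E.
Proof.
move=> mB; have := indepX [set i : 'I_n | (k <= i)%N]%SET mB.
under eq_bigl do rewrite inE.
by move=> <-; congr (P _); apply/seteqP; split=> w /= h i;
  have := h i; rewrite inE.
Qed.

Lemma futureS (i : 'I_n) B : future i B = X i @^-1` B i `&` future i.+1 B.
Proof.
apply/seteqP; split=> [w /= h|w [/= hi h] j /=].
  by split=> [|j ij]; apply: h => //; exact: ltnW.
by rewrite leq_eqVlt => /predU1P[/val_inj <-|]//; exact: h.
Qed.

(** Induction on k. Independence from the whole future, not only from the next
    increment, is what the induction needs: if the stopped walk at time k is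
    independent of X_k, X_{k+1}, ..., then the pair made of it and X_k is
    independent of X_{k+1}, ..., and so is any function of that pair. *)
Lemma stopped_walk_independent_future k A B : (k <= n)%N ->
    measurable A -> (forall i, measurable (B i)) ->
  P (stopped_walk k @^-1` A `&` future k B) =
  (P (stopped_walk k @^-1` A) * P (future k B))%E.
Proof.
elim: k A B => [|k IH] A B kn mA mB.
  (* a constant: its preimages have probability 0 or 1 *)
  rewrite (_ : stopped_walk 0 = cst 0)// preimage_cst.
  by case: ifPn => _; rewrite ?set0I ?measure0 ?mul0e// setTI probability_setT mul1e.
pose i := Ordinal kn.
pose upd (C : set R) (D : 'I_n -> set R) j := if j == i then C else D j.
have mupd C D : measurable C -> (forall j, measurable (D j)) ->
    forall j, measurable (upd C D j).
  by move=> mC mD j; rewrite /upd; case: ifP.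
have futureU C D : future i (upd C D) = X i @^-1` C `&` future i.+1 D.
  rewrite futureS /upd eqxx; congr (_ `&` _).
  by apply/seteqP; split=> w h j ij; have := h j ij;
    case: eqP ij => // ->; rewrite /= ltnn.
have PfutureU C D : measurable C -> (forall j, measurable (D j)) ->
    P (X i @^-1` C `&` future i.+1 D) = (P (X i @^-1` C) * P (future i.+1 D))%E.
  move=> mC mD; rewrite -futureU !futureE//; last exact: mupd.
  rewrite (bigD1 i)//= /upd eqxx; congr (_ * _)%E.
  apply: eq_big => [j|j /andP[_ /negPf ->]//].
  by rewrite [in RHS]ltn_neqAle andbC eq_sym.
have futureT : future i.+1 (fun=> setT) = setT by apply/seteqP; split.
have rect C D : measurable C -> measurable D ->
    P (stopped_walk k @^-1` C `&` X i @^-1` D) =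
    (P (stopped_walk k @^-1` C) * P (X i @^-1` D))%E.
  move=> mC mD; have := IH C (upd D (fun=> setT)) (ltnW kn) mC.
  rewrite -[k]/(i : nat) futureU futureT setIT; apply.
  exact: mupd.
have mgA : measurable (stopped_step @^-1` A).
  by rewrite -[X in measurable X]setTI; exact: measurable_stopped_step.
have ZS : stopped_walk k.+1 = stopped_step \o (fun w => (stopped_walk k w, X i w)).
  by apply/funext => w; rewrite -[k.+1]/(i.+1) stopped_walkS.
rewrite ZS comp_preimage.
apply: (independent_event_of_rectangles (measurable_stopped_walk k) (mX i)) => //.
  exact: measurable_future.
move=> C D mC mD; rewrite rect// -setIA -[k.+1]/(i.+1) -futureU.
rewrite -[k]/(i : nat) IH ?(ltnW kn)//; last exact: mupd.
by rewrite futureU PfutureU// muleA.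
Qed.

Lemma integral_stopped_walkS (i : 'I_n) (f : R -> \bar R) :
    measurable_fun setT f -> (forall y, 0 <= f y)%E ->
  (\int[P]_w f (stopped_walk i.+1 w) =
   \int[P]_w \int[P]_w' f (stopped_step (stopped_walk i w, X i w')))%E.
Proof.
move=> mf f0.
rewrite -(@ge0_integral_independent_pair _ _ _ _ _ _ _ P (stopped_walk i) (X i)
  (measurable_stopped_walk i) (mX i) (f \o stopped_step))//.
- by apply: eq_integral => w _; rewrite stopped_walkS.
- move=> A D mA mD.
  pose B j := if j == i then D else setT.
  have mB j : measurable (B j) by rewrite /B; case: ifP.
  have <- : future i B = X i @^-1` D.
    rewrite futureS /B eqxx (_ : future i.+1 _ = setT) ?setIT//.
    apply/seteqP; split=> // w _ j; case: eqP => // ->.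
    by rewrite ltnn.
  by apply: stopped_walk_independent_future => //; exact: ltnW.
- by apply: measurableT_comp => //; exact: measurable_stopped_step.
- by move=> y; exact: f0.
Qed.

End StoppedWalk.

(** * Survival of the stopped walk *)

Lemma measurable_norm_le d (T : measurableType d) (R : realType) (f : T -> R)
    (a : R) : measurable_fun setT f -> measurable [set w | `|f w| <= a].
Proof.
move=> mf; rewrite -[X in measurable X]setTI.
by apply: measurable_fun_le => //; exact: measurableT_comp.
Qed.

Section SmallBall.
Context d (T : measurableType d) (R : realType) (P : probability T R).
Variables (A sigma L : R).
Hypotheses (A0 : 0 < A) (sigma0 : 0 < sigma) (L0 : 0 < L).

(** A lower bound for E X^+ and E X^- under the moment conditions; its square
    bounds the one-sided second moments from below. *)
Definition spread : R := sigma ^+ 4 / (2 * A).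

(** The constant K of the one-step estimate; 1 + A bounds E X^2, because
    x^2 <= 1 + |x|^3. *)
Definition drift_rate : R :=
  2 * (1 + A) * (2 + 4 * (1 + A) / spread ^+ 2).

Hypothesis AL : 8 * A <= spread ^+ 2 * L.

Lemma measurable_bump : measurable_fun setT (bump L : R -> R).
Proof.
apply: measurable_funX; apply: measurable_maxr; first exact: measurable_cst.
by apply: measurable_funB; [exact: measurable_cst|exact: measurable_funX].
Qed.

Lemma integral_bump_ge (X : {RV P >-> R}) z :
    ('E_P[X] = 0)%E -> ('E_P[fun w => (`|X w| ^+ 3)%R] <= A%:E)%E ->
    ((sigma ^+ 2)%:E <= 'E_P[fun w => (X w ^+ 2)%R])%E -> `|z| <= L ->
  (((1 - drift_rate / L ^+ 2) * bump L z)%:E <=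
   \int[P]_w (bump L (z + X w))%:E)%E.
Proof.
move=> X1 X3 X2 zL.
have X3y : ('E_P[fun w => (`|X w| ^+ 3)%R] < +oo)%E.
  by rewrite (le_lt_trans X3)// ltry.
have [i1 i2 i3] := integrable_of_third_moment X3y.
set m2 := fine 'E_P[fun w => (X w ^+ 2)%R]%E.
set m3 := fine 'E_P[fun w => (`|X w| ^+ 3)%R]%E.
have f2 : ('E_P[fun w => (X w ^+ 2)%R] = m2%:E)%E.
  by rewrite /m2 fineK// unlock; exact: (integrable_fin_num measurableT).
have f3 : ('E_P[fun w => (`|X w| ^+ 3)%R] = m3%:E)%E.
  by rewrite /m3 fineK// unlock; exact: (integrable_fin_num measurableT).
have m2s : sigma ^+ 2 <= m2 by rewrite -lee_fin -f2.
have m3A : m3 <= A by rewrite -lee_fin -f3.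
have m30 : 0 <= m3.
  by rewrite fine_ge0// expectation_ge0// => w; rewrite exprn_ge0.
have m2A : m2 <= 1 + A.
  apply: (@le_trans _ _ (1 + m3)); last by rewrite lerD2l.
  have i0 : P.-integrable setT (fun=> 1%:E) by exact: finite_measure_integrable_cst.
  have := le_integral measurableT i2 (integrableD measurableT i0 i3).
  rewrite (integralD measurableT i0 i3); move: f2 f3; rewrite !unlock => -> ->.
  rewrite integral_cst//= probability_setT mule1 -EFinD lee_fin; apply.
  move=> w _; rewrite -EFinD lee_fin -(real_normK (num_real (X w))).
  by have [] := le_1Dcube (normr_ge0 (X w)).
have s0 : 0 < spread by rewrite divr_gt0 ?exprn_gt0// mulr_gt0.
have [||||||||c0 [c1 [c2 [c3 [cf]]]]] :=
  @bump_cubic_minorant _ L z A (1 + A) (sigma ^+ 2 / A) spread m2 m3 => //.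
- by rewrite addr_ge0// ltW.
- by rewrite m30 m3A.
- exact: third_moment_spread.
rewrite -/drift_rate -lee_fin => h; apply: (le_trans h).
apply: (@integral_ge_cubic _ _ _ _ X (fun x => bump L (z + x)) (L ^+ 4)
  c0 c1 c2 c3) => //.
  by apply: (measurableT_comp measurable_bump); exact: measurable_funD.
by move=> x; rewrite bump_ge0 bump_le.
Qed.

Variables (n : nat) (X : 'I_n -> {RV P >-> R}).
Hypothesis indepX : independent_RVs X.
Hypothesis X1 : forall i, ('E_P[X i] = 0)%E.
Hypothesis X3 : forall i, ('E_P[fun w => (`|X i w| ^+ 3)%R] <= A%:E)%E.
Hypothesis X2 : forall i, ((sigma ^+ 2)%:E <= 'E_P[fun w => (X i w ^+ 2)%R])%E.
Hypothesis rate1 : drift_rate <= L ^+ 2.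

Let q := 1 - drift_rate / L ^+ 2.

Let q0 : 0 <= q.
Proof. by rewrite /q subr_ge0 ler_pdivrMr ?mul1r// exprn_gt0. Qed.

(** Once the walk has left [-L, L] the bump is 0 and stays 0, so the one-step
    estimate holds from every position of the stopped walk. *)
Lemma integral_bump_stopped_walk_ge k : (k <= n)%N ->
  ((q ^+ k * L ^+ 4)%:E <= \int[P]_w (bump L (stopped_walk X L k w))%:E)%E.
Proof.
have mb := measurable_bump.
have mbE : measurable_fun setT (EFin \o bump L) by exact/measurable_EFinP.
elim: k => [_|k IH kn].
  under eq_integral do rewrite /= bump0.
  by rewrite integral_cst//= probability_setT mule1 mul1r.
pose i := Ordinal kn.
rewrite -[k.+1]/(i.+1).
rewrite (integral_stopped_walkS L indepX i mbE); last first.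
  by move=> y; rewrite lee_fin bump_ge0.
apply: (@le_trans _ _ (\int[P]_w (q%:E * (bump L (stopped_walk X L k w))%:E))%E).
  rewrite ge0_integralZl//; last 2 first.
  - exact: (measurableT_comp mbE (measurable_stopped_walk X L k)).
  - by move=> w _; rewrite lee_fin bump_ge0.
  - by rewrite exprS -mulrA EFinM lee_wpmul2l ?lee_fin// IH// ltnW.
apply: ge0_le_integral => //.
- by move=> w _; rewrite -EFinM lee_fin mulr_ge0 ?bump_ge0.
- apply/measurable_EFinP; apply: measurable_funM => //.
  exact: (measurableT_comp mb (measurable_stopped_walk X L k)).
- apply: (@measurable_fun_fubini_tonelli_F _ _ T T R P
    (fun v => (bump L (stopped_step L (stopped_walk X L i v.1, X i v.2)))%:E)).
  + apply: (measurableT_comp mbE).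
    apply: (measurableT_comp (measurable_stopped_step L)).
    apply: measurable_fun_pair.
      exact: (measurableT_comp (measurable_stopped_walk X L i) measurable_fst).
    exact: (measurableT_comp (measurable_funP (X i)) measurable_snd).
  + by move=> v; rewrite lee_fin bump_ge0.
- move=> w _; have [Zw|Zw] := boolP (`|stopped_walk X L i w| <= L).
    rewrite /stopped_step /= Zw -EFinM.
    exact: integral_bump_ge.
  rewrite (bump_out (ltW L0)); last by rewrite ltNge.
  by rewrite mule0; apply: integral_ge0 => w' _; rewrite lee_fin bump_ge0.
Qed.

(** Markov's inequality in reverse: bump L / L^4 lies below the indicator of
    [-L, L]. *)
Lemma small_ball_stopped_walk :
  ((q ^+ n)%:E <= P [set w | (`|stopped_walk X L n w| <= L)%R])%E.
Proof.
have L40 : 0 < L ^+ 4 by rewrite exprn_gt0.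
have mZ := measurable_stopped_walk X L n.
have mE := measurable_norm_le L mZ.
have mI : measurable_fun setT (\1_[set w | `|stopped_walk X L n w| <= L] : T -> R).
  exact: measurable_indic.
rewrite -(@lee_pmul2l _ (L ^+ 4)%:E)// -EFinM mulrC.
apply: (le_trans (integral_bump_stopped_walk_ge (leqnn n))).
rewrite -(setIT [set w | _]) -integral_indic// -ge0_integralZl//; last 2 first.
- exact/measurable_EFinP.
- by rewrite lee_fin ltW.
apply: ge0_le_integral => //.
- by move=> w _; rewrite lee_fin bump_ge0.
- apply/measurable_EFinP.
  exact: (measurableT_comp measurable_bump mZ).
- by apply/measurable_EFinP; exact: measurable_funM.
move=> w _; rewrite -EFinM lee_fin indicE.
have [Zw|Zw] := boolP (`|stopped_walk X L n w| <= L).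
  by rewrite mem_set// mulr1 bump_le.
by rewrite (bump_out (ltW L0)) ?ltNge// mulr_ge0// ltW.
Qed.

End SmallBall.

(** * The theorem *)

Lemma expRN2_le_1B (R : realType) (t : R) : 0 <= t <= 1 / 2 ->
  expR (- (2 * t)) <= 1 - t.
Proof.
move=> /andP[t0 t1]; have t1_gt0 : 0 < 1 - t by lra.
rewrite expRN -[leRHS]invrK lef_pV2 ?posrE ?expR_gt0 ?invr_gt0//.
apply: le_trans (expR_ge1Dx _); rewrite -div1r ler_pdivrMr//.
by nra.
Qed.

Theorem lemma3p3 (R : realType) (A sigma : R) (hA : 0 < A) (hsigma : 0 < sigma) :
  exists (c lambda0 : R) (n0 : nat),
    [/\ 0 < c, 0 <= lambda0, (1 <= n0)%N &
      forall (n : nat), (n0 <= n)%N ->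
      forall (d : measure_display) (T : measurableType d) (P : probability T R)
        (X : 'I_n -> {RV P >-> R}),
        independent_RVs X ->
        (forall i : 'I_n, ('E_P[X i] = 0)%E) ->
        (forall i : 'I_n, ('E_P[fun w => (`|X i w| ^+ 3)%R] <= A%:E)%E) ->
        (forall i : 'I_n, ((sigma ^+ 2)%:E <= 'E_P[fun w => (X i w ^+ 2)%R])%E) ->
        forall lambda : R, lambda0 <= lambda ->
          ((expR (- (c * n%:R / lambda ^+ 2)))%:E <=
           P [set w | (\big[Num.max/0]_(1 <= k < n.+1) `|walk X k w| <= lambda)%R
                      /\ (`|walk X n w| <= lambda / 2)%R])%E].
Proof.
pose s := spread A sigma; pose K := drift_rate A sigma.
have s0 : 0 < s by rewrite divr_gt0 ?exprn_gt0// mulr_gt0.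
have t0 : 0 < s ^+ 2 by rewrite exprn_gt0.
have A1 : 0 < 1 + A by rewrite addr_gt0.
have K0 : 0 < K.
  by rewrite !mulr_gt0// addr_gt0// divr_gt0// mulr_gt0.
have As0 : 0 < 8 * A / s ^+ 2 by rewrite divr_gt0// mulr_gt0.
(* the three summands give L >= 1, 8 A <= s^2 L and 2 K <= L <= L^2 *)
exists (8 * K), (2 * (1 + 8 * A / s ^+ 2 + 2 * K)), 1%N; split => //.
- by rewrite mulr_gt0.
- by lra.
move=> n n1 d T P X indepX X1 X3 X2 lambda hlambda.
pose L := lambda / 2.
have lambdaE : lambda = 2 * L by rewrite /L; field.
have hL : 1 + 8 * A / s ^+ 2 + 2 * K <= L by move: hlambda; rewrite lambdaE; lra.
have L1 : 1 <= L by lra.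
have L0 : 0 < L by lra.
have AL : 8 * A <= s ^+ 2 * L by rewrite -ler_pdivrMl// mulrC; lra.
have KL : 2 * K <= L ^+ 2 by nra.
have L20 : 0 < L ^+ 2 by rewrite exprn_gt0.
have KL1 : K <= L ^+ 2 by lra.
have := small_ball_stopped_walk hA hsigma L0 AL indepX X1 X3 X2 KL1.
rewrite -/K => stay; apply: le_trans (le_trans stay _).
  rewrite lee_fin (_ : - (8 * K * n%:R / lambda ^+ 2) =
      n%:R * - (2 * (K / L ^+ 2))); last first.
    by rewrite lambdaE; field; rewrite gt_eqF.
  rewrite expRM_natl lerXn2r ?nnegrE ?expR_ge0//.
    by rewrite subr_ge0 ler_pdivrMr ?mul1r.
  apply: expRN2_le_1B; rewrite divr_ge0 ?(ltW K0) ?(ltW L20)//=.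
  by rewrite ler_pdivrMr//; lra.
have mW k : measurable_fun setT (walk X k) by exact: measurable_walk.
have mmax (r : seq nat) :
    measurable_fun setT (fun w => \big[Num.max/0]_(k <- r) `|walk X k w|).
  elim: r => [|k r IH].
    by under eq_fun do rewrite big_nil; exact: measurable_cst.
  under eq_fun do rewrite big_cons.
  by apply: measurable_maxr => //; exact: measurableT_comp.
apply: le_measure; rewrite ?inE.
- exact: measurable_norm_le (measurable_stopped_walk X L n).
- apply: measurableI; last exact: measurable_norm_le.
  rewrite -[X in measurable X]setTI.
  by apply: measurable_fun_le => //; exact: mmax.
- move=> w /= /stopped_walk_in[_ inL]; split; last exact: inL.
  rewrite big_nat; elim/big_ind: _ => [|x y xl yl|k /andP[_ kn]].
  + by rewrite lambdaE; lra.
  + by rewrite ge_max xl yl.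
  + by rewrite lambdaE (le_trans (inL _ kn))//; lra.
Qed.
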